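(* Let $I$ be a set. The set of free ultrafilters on $I$ is in canonical bijection with $$\varprojlim_{\Delta\in \mathcal{FP}(I)} \mathrm{Big}(\Delta).$$ Furthermore, the set of all ultrafilters on $I$ is in canonical bijection with $$\varprojlim_{\Delta\in \mathcal{FP}(I)} \Delta.$$
   Context: An ultrafilter on a set $S$ is a subset $\mathcal{U}$ of the power set $2^S$ such that: (1) $\emptyset\notin\mathcal{U}$; (2) if $A\in\mathcal{U}$ and $A\subset B\subset S$ then $B\in\mathcal{U}$; (3) if $A,B\in\mathcal{U}$ then $A\cap B\in\mathcal{U}$; (4) if $A\subset S$ and $A\notin\mathcal{U}$ then $S\setminus A\in\mathcal{U}$. An ultrafilter is free if it contains no finite sets. $\mathcal{FP}(I)$ denotes the set of finite partitions of $I$ (finite sets $\Delta$ of nonempty, pairwise disjoint subsets of $I$ with union $I$), and $\mathcal{FPS}(I)$ denotes the set of finite partitions of subsets of $I$. The latter is partially ordered by: $\Delta'\leq\Delta$ if and only if for every $D'\in\Delta'$ there is a unique $D\in\Delta$ with $D'\subset D$. For $\Delta'\leq\Delta$ the transition map $\psi_{\Delta',\Delta}:\Delta'\to\Delta$ sends $A\in\Delta'$ to the $B\in\Delta$ with $A\subset B$. This makes $\mathcal{FPS}(I)$ an inverse family of sets, and $\mathcal{FP}(I)\subset\mathcal{FPS}(I)$ carries the induced order and maps. The function $\mathrm{Big}:\mathcal{FP}(I)\to\mathcal{FPS}(I)$ is given by $\mathrm{Big}(\Delta)=\{D\in\Delta: D\text{ is infinite}\}$. For $\Delta'\le\Delta$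 in $\mathcal{FP}(I)$, the transition map $\mathrm{Big}(\Delta')\to\mathrm{Big}(\Delta)$ likewise sends each $A$ to the $B\in \mathrm{Big}(\Delta)$ with $A\subset B$. Inverse limits are taken in the category of sets: for an inverse family $(X_i,f_{ij}:X_i\to X_j)$, $\varprojlim X_i=\{(a_i)\in\prod X_i: a_j=f_{ij}(a_i)\text{ for all } f_{ij}\}$ (possibly empty). *)

(* Defs.v *)
From mathcomp Require Import all_boot.
From mathcomp Require Import boolp classical_sets functions cardinality.

Set Implicit Arguments.
Unset Strict Implicit.
Unset Printing Implicit Defensive.

Local Open Scope classical_set_scope.

(** Ultrafilters.  On an empty [S] there are none: the fourth clause applied
    to [set0] contradicts the first one. *)

Definition ultrafilters (S : Type) : set (set (set S)) :=
  [set U | [/\ ~ U set0,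
               forall A B, U A -> A `<=` B -> U B,
               forall A B, U A -> U B -> U (A `&` B)
             & forall A, ~ U A -> U (~` A)]].

Definition free_ultrafilters (S : Type) : set (set (set S)) :=
  [set U | ultrafilters U /\ forall A, U A -> infinite_set A].

Arguments ultrafilters S : clear implicits.
Arguments free_ultrafilters S : clear implicits.

(** Inverse families of sets and their limits.  Transition maps go from the
    smaller index to the larger one. *)

Record inverse_family (J : Type) (le : J -> J -> Prop) := InverseFamily {
  fam_obj :> J -> Type;
  fam_map : forall i j, le i j -> fam_obj i -> fam_obj j;
  fam_map_id : forall i (h : le i i) x, fam_map h x = x;
  fam_map_comp : forall i j k (hij : le i j) (hjk : le j k) (hik : le i k) x,
    fam_map hjk (fam_map hij x) = fam_map hik x }.

Definition inverse_limit J (le : J -> J -> Prop) (X : inverse_family le) :=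
  {a : forall i, X i | forall i j (h : le i j), a j = fam_map h (a i)}.

Definition lim_proj J (le : J -> J -> Prop) (X : inverse_family le) (j : J)
  (a : inverse_limit X) : X j := sval a j.

Definition pullback_family J K (leJ : J -> J -> Prop) (leK : K -> K -> Prop)
    (phi : J -> K) (mono : forall i j, leJ i j -> leK (phi i) (phi j))
    (X : inverse_family leK) : inverse_family leJ :=
  @InverseFamily J leJ (fun j => X (phi j))
    (fun i j h => fam_map (mono i j h))
    (fun i h => fam_map_id (mono i i h))
    (fun i j k hij hjk hik =>
       fam_map_comp (mono i j hij) (mono j k hjk) (mono i k hik)).

(** Finite partitions. *)

Definition FPS (I : Type) : set (set (set I)) :=
  [set Delta | finite_set Delta /\ exists A : set I, partition Delta id A].

Definition FP (I : Type) : set (set (set I)) :=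
  [set Delta | finite_set Delta /\ partition Delta id [set: I]].

Arguments FPS I : clear implicits.
Arguments FP I : clear implicits.

Definition refines (I : Type) (Delta' Delta : set (set I)) : Prop :=
  forall D', Delta' D' -> exists! D, Delta D /\ D' `<=` D.

Definition FPS_le (I : Type) (Delta' Delta : FPS I) : Prop :=
  refines (val Delta') (val Delta).

Definition FP_le (I : Type) (Delta' Delta : FP I) : Prop :=
  refines (val Delta') (val Delta).

Lemma FPS_block_unique (I : Type) (Delta : set (set I)) (C D E : set I) :
  FPS I Delta -> C !=set0 -> Delta D -> Delta E -> C `<=` D -> C `<=` E -> D = E.
Proof.
move=> [_ [A [_ tD _]]] [x Cx] dD dE CD CE.
by apply: tD => //; exists x; split; [exact: CD | exact: CE].
Qed.

Lemma FPS_block_nonempty (I : Type) (Delta : set (set I)) (D : set I) :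
  FPS I Delta -> Delta D -> D !=set0.
Proof. by move=> [_ [A [_ _ ne]]]; exact: ne. Qed.

Lemma FPS_le_refl (I : Type) (Delta : FPS I) : FPS_le Delta Delta.
Proof.
have P := set_valP Delta.
move=> D dD; exists D; split=> [|E [dE DE]]; first by split.
exact: (FPS_block_unique P (FPS_block_nonempty P dD) dD dE).
Qed.

Lemma FPS_le_trans (I : Type) (Delta1 Delta2 Delta3 : FPS I) :
  FPS_le Delta1 Delta2 -> FPS_le Delta2 Delta3 -> FPS_le Delta1 Delta3.
Proof.
move=> le12 le23 D1 d1.
have [D2 [[d2 D12] _]] := le12 _ d1.
have [D3 [[d3 D23] _]] := le23 _ d2.
have D13 : D1 `<=` D3 by exact: subset_trans D23.
exists D3; split=> // E [dE DE].
exact: (FPS_block_unique (set_valP Delta3)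
         (FPS_block_nonempty (set_valP Delta1) d1) d3 dE).
Qed.

Lemma FPS_le_anti (I : Type) (Delta Delta' : FPS I) :
  FPS_le Delta Delta' -> FPS_le Delta' Delta -> Delta = Delta'.
Proof.
have half (X Y : FPS I) : FPS_le X Y -> FPS_le Y X -> val X `<=` val Y.
  move=> leXY leYX D dD.
  have [E [[dE DE] _]] := leXY _ dD.
  have [F [[dF EF] _]] := leYX _ dE.
  have DF := FPS_block_unique (set_valP X)
    (FPS_block_nonempty (set_valP X) dD) dD dF (@subset_refl _ D)
    (subset_trans DE EF).
  by suff -> : D = E by []; rewrite eqEsubset; split=> //; rewrite DF.
move=> le1 le2; apply: val_inj; rewrite eqEsubset.
by split; exact: half.
Qed.

Lemma psi_exists (I : Type) (Delta' Delta : set (set I))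
    (h : refines Delta' Delta) (A : Delta') :
  exists B : Delta, val A `<=` val B.
Proof.
have [B [[dB AB] _]] := h _ (set_valP A).
by exists (SigSub (mem_set dB)).
Qed.

Definition psi (I : Type) (Delta' Delta : set (set I))
    (h : refines Delta' Delta) (A : Delta') : Delta :=
  sval (cid (psi_exists h A)).

Lemma psiP (I : Type) (Delta' Delta : set (set I))
    (h : refines Delta' Delta) (A : Delta') :
  val A `<=` val (psi h A).
Proof. exact: svalP (cid (psi_exists h A)). Qed.

Lemma psi_unique (I : Type) (Delta' Delta : FPS I) (h : FPS_le Delta' Delta)
    (A : val Delta') (B : val Delta) :
  val A `<=` val B -> psi h A = B.
Proof.
move=> AB; apply: val_inj.
have neA := FPS_block_nonempty (set_valP Delta') (set_valP A).
exact: (FPS_block_unique (set_valP Delta) neA (set_valP (psi h A)) (set_valP B)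
  (@psiP I _ _ h A) AB).
Qed.

Lemma psi_id (I : Type) (Delta : FPS I) (h : FPS_le Delta Delta)
  (A : val Delta) : psi h A = A.
Proof. exact: psi_unique. Qed.

Lemma psi_comp (I : Type) (Delta1 Delta2 Delta3 : FPS I)
    (h12 : FPS_le Delta1 Delta2) (h23 : FPS_le Delta2 Delta3)
    (h13 : FPS_le Delta1 Delta3) (A : val Delta1) :
  psi h23 (psi h12 A) = psi h13 A.
Proof.
have s12 := @psiP I _ _ h12 A.
have s23 := @psiP I _ _ h23 (psi h12 A).
apply/esym/psi_unique; exact: subset_trans s12 s23.
Qed.

Definition FPS_family (I : Type) : inverse_family (@FPS_le I) :=
  @InverseFamily (FPS I) (@FPS_le I) (fun Delta => set_type (val Delta))
    (fun Delta' Delta h => psi h) (@psi_id I) (@psi_comp I).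

Lemma FP_sub_FPS (I : Type) : FP I `<=` FPS I.
Proof. by move=> Delta [fD pD]; split=> //; exists [set: I]. Qed.

Definition FP_incl (I : Type) (Delta : FP I) : FPS I :=
  SigSub (mem_set (FP_sub_FPS (set_valP Delta))).

Lemma FP_incl_mono (I : Type) (Delta' Delta : FP I) :
  FP_le Delta' Delta -> FPS_le (FP_incl Delta') (FP_incl Delta).
Proof. by []. Qed.

Definition FP_family (I : Type) : inverse_family (@FP_le I) :=
  pullback_family (@FP_incl_mono I) (FPS_family I).

Definition big_blocks (I : Type) (Delta : set (set I)) : set (set I) :=
  [set D | Delta D /\ infinite_set D].

Lemma big_blocks_FPS (I : Type) (Delta : FP I) : FPS I (big_blocks (val Delta)).
Proof.
have [fD [_ tD neD]] := set_valP Delta; split.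
  by apply: sub_finite_set fD => D [].
exists (cover (big_blocks (val Delta)) id); split=> //.
- by move=> D E [dD _] [dE _]; exact: tD.
- by move=> D [dD _]; exact: neD.
Qed.

Definition Big (I : Type) (Delta : FP I) : FPS I :=
  SigSub (mem_set (big_blocks_FPS Delta)).

Lemma Big_mono (I : Type) (Delta' Delta : FP I) :
  FP_le Delta' Delta -> FPS_le (Big Delta') (Big Delta).
Proof.
move=> le D' [dD' infD'].
have [D [[dD D'D] uD]] := le _ dD'.
exists D; split.
  by split=> //; split=> // fD; apply: infD'; exact: sub_finite_set fD.
by move=> E [[dE _] D'E]; exact: uD.
Qed.

Definition Big_family (I : Type) : inverse_family (@FP_le I) :=
  pullback_family (@Big_mono I) (FPS_family I).

(* Main.v *)
Require Import Defs.
From mathcomp Require Import all_boot.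
From mathcomp Require Import boolp classical_sets functions cardinality.

(** An ultrafilter contains exactly one block of every finite partition: if it
    contained none, it would contain all their complements, whose finite
    intersection is empty ([ultrafilter_partition]); two would meet
    ([ultrafilter_block_unique]).  The block in the ultrafilter for a partition
    is contained in the one for any coarser partition, so the chosen blocks
    form a point of the inverse limit.

    Conversely, let blocks [s Delta] be chosen coherently.  Then the sets that
    contain some [s Delta] form an ultrafilter ([selected_ultrafilter]).
    Closure under intersection holds because any two finite partitions have a
    common refinement, and the maximality axiom for [A] comes from the partition
    into [A] and its complement.  This ultrafilter contains a block of [Delta]
    exactly when that block is [s Delta] ([selectedP]), which makes the two
    constructions mutually inverse.

    Both bijections are instances of one statement, [ultrafilters_limit], about
    a monotone choice of sub-collections of blocks [phi Delta] of [Delta]: the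
    limit of the [phi Delta] classifies the ultrafilters whose chosen blocks
    always lie in [phi Delta].  For [phi = FP_incl] these are all ultrafilters.
    For [phi = Big] they are the free ones: an ultrafilter that contains a
    finite set [A] picks the finite block [A] of the partition into [A] and its
    complement. *)

Set Implicit Arguments.
Unset Strict Implicit.
Unset Printing Implicit Defensive.

Local Open Scope classical_set_scope.

Section UltrafilterLimits.
Variable I : Type.
Implicit Types (U : set (set I)) (A B D : set I) (Delta : FP I).

(** * Ultrafilters and the blocks of a finite partition *)

Lemma ultrafilter_ne U A : ultrafilters I U -> U A -> A !=set0.
Proof.
by move=> [U0 _ _ _] UA; apply/set0P/eqP => A0; apply: U0; rewrite -A0.
Qed.

Lemma ultrafilterT U : ultrafilters I U -> U [set: I].
Proof. by case=> U0 _ _ UC; rewrite -setC0; exact: UC. Qed.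

Lemma ultrafilter_block_unique U Delta D E :
  ultrafilters I U -> val Delta D -> val Delta E -> U D -> U E -> D = E.
Proof.
move=> uU dD dE UD UE; have [_ [_ tD _]] := set_valP Delta.
have [_ _ UI _] := uU.
by apply: tD => //; apply: (ultrafilter_ne uU); exact: UI.
Qed.

(** If every block were missing from [U], the finite intersection of their
    complements, which is empty, would be in [U]. *)
Lemma ultrafilter_partition U Delta :
  ultrafilters I U -> exists2 D, val Delta D & U D.
Proof.
move=> uU; have [_ Uup UI UC] := uU.
have [fD [cD _ _]] := set_valP Delta.
have [s sE] := (@finite_seqP {eclassic set I} (val Delta)).1 fD.
apply: contrapT => noD.
(* The points outside the first few blocks form a member of [U]; for the full
   list of blocks there is no such point. *)
have avoid (t : seq {eclassic set I}) : (forall D, D \in t -> ~ U D) ->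
    U [set x | forall D : {eclassic set I}, D \in t -> ~ (D : set I) x].
  elim: t => [_|E t IHt tU].
    by apply: Uup (ultrafilterT uU) _ => x _ D; rewrite in_nil.
  have UE : U (~` (E : set I)) by apply/UC/tU; rewrite mem_head.
  have Ut := IHt (fun D Dt => tU D (mem_behead (s := E :: t) Dt)).
  apply: Uup (UI _ _ UE Ut) _ => x [Ex tx] D.
  by rewrite in_cons => /orP[/eqP ->|/tx].
have Us : U [set x | forall D : {eclassic set I}, D \in s -> ~ (D : set I) x].
  apply: avoid => D Ds UD; apply: noD; exists D => //.
  by rewrite sE.
have [x sx] := ultrafilter_ne uU Us.
have [D dD Dx] : cover (val Delta) id x by rewrite cD.
by apply: (sx D) => //; rewrite sE in dD.
Qed.

(** * The directed order on finite partitions *)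

(** Every block has at most one superset in a partition, so the uniqueness in
    [refines] comes for free. *)
Lemma FP_leP Delta' Delta :
  (forall D', val Delta' D' -> exists2 D, val Delta D & D' `<=` D) ->
  FP_le Delta' Delta.
Proof.
move=> sub D' dD'; have [D dD D'D] := sub _ dD'.
have ne : D' !=set0 by have [_ [_ _ +]] := set_valP Delta'; exact.
exists D; split=> // E [dE D'E].
exact: (FPS_block_unique (FP_sub_FPS (set_valP Delta)) ne).
Qed.

(** An empty [A] or an empty complement is discarded, as blocks are nonempty. *)
Definition split_blocks A : set (set I) :=
  [set D | (D = A \/ D = ~` A) /\ D !=set0].

Lemma split_blocks_FP A : FP I (split_blocks A).
Proof.
split; first by apply: sub_finite_set (finite_set2 A (~` A)) => D [].
split; last by move=> D [].
- apply/seteqP; split=> // x _; have [Ax|nAx] := pselect (A x).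
    by exists A => //; split; [left|exists x].
  by exists (~` A) => //; split; [right|exists x].
- by move=> D E [[->|->] _] [[->|->] _] [x []].
Qed.

Definition split_FP A : FP I := SigSub (mem_set (split_blocks_FP A)).

Definition meet_blocks Delta1 Delta2 : set (set I) :=
  [set D1 `&` D2 | D1 in val Delta1 & D2 in val Delta2] `&` [set D | D !=set0].

Lemma meet_blocks_FP Delta1 Delta2 : FP I (meet_blocks Delta1 Delta2).
Proof.
have [f1 [c1 t1 _]] := set_valP Delta1.
have [f2 [c2 t2 _]] := set_valP Delta2.
split; first by apply: sub_finite_set (finite_image2 setI f1 f2) => D [].
split; last by move=> D [].
- apply/seteqP; split=> // x _.
  have [D1 d1 D1x] : cover (val Delta1) id x by rewrite c1.
  have [D2 d2 D2x] : cover (val Delta2) id x by rewrite c2.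
  exists (D1 `&` D2) => //; split; last by exists x.
  by exists D1 => //; exists D2.
- move=> _ _ [[D1 d1 [D2 d2 <-]] _] [[E1 e1 [E2 e2 <-]] _].
  move=> [x [[D1x D2x] [E1x E2x]]].
  have -> : D1 = E1 by apply: t1 => //; exists x.
  by have -> : D2 = E2 by apply: t2 => //; exists x.
Qed.

Definition meet_FP Delta1 Delta2 : FP I :=
  SigSub (mem_set (meet_blocks_FP Delta1 Delta2)).

Lemma meet_FP_lel Delta1 Delta2 : FP_le (meet_FP Delta1 Delta2) Delta1.
Proof.
by apply: FP_leP => _ [[D1 d1 [D2 d2 <-]] _]; exists D1 => // x [].
Qed.

Lemma meet_FP_ler Delta1 Delta2 : FP_le (meet_FP Delta1 Delta2) Delta2.
Proof.
by apply: FP_leP => _ [[D1 d1 [D2 d2 <-]] _]; exists D2 => // x [].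
Qed.

(** * The ultrafilter of a coherent choice of blocks *)

Definition coherent_selection (s : FP I -> set I) : Prop :=
  (forall Delta, val Delta (s Delta)) /\
  (forall Delta' Delta, FP_le Delta' Delta -> s Delta' `<=` s Delta).

Definition selected (s : FP I -> set I) : set (set I) :=
  [set A | exists Delta, s Delta `<=` A].

(** Coherence makes the chosen blocks a filter base: the block chosen in a
    common refinement lies in both of the blocks chosen in the two coarser
    partitions. *)
Lemma selected_ultrafilter s :
  coherent_selection s -> ultrafilters I (selected s).
Proof.
move=> [s_in s_mono].
have s_ne Delta : s Delta !=set0.
  by have [_ [_ _ +]] := set_valP Delta; apply; exact: s_in.
split.
- by move=> [Delta s0]; have [x /s0] := s_ne Delta.
- by move=> A B [Delta sA] AB; exists Delta; exact: subset_trans AB.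
- move=> A B [Delta1 sA] [Delta2 sB]; exists (meet_FP Delta1 Delta2) => x sx.
  split.
    by apply: sA; apply: (s_mono _ _ (@meet_FP_lel Delta1 Delta2)).
  by apply: sB; apply: (s_mono _ _ (@meet_FP_ler Delta1 Delta2)).
- move=> A nA; have [[sA|sA] _] := s_in (split_FP A).
    by case: nA; exists (split_FP A); rewrite sA.
  by exists (split_FP A); rewrite sA.
Qed.

(** Two members of an ultrafilter meet, so the ultrafilter cannot contain a
    block of [Delta] besides the chosen one. *)
Lemma selectedP s Delta D : coherent_selection s -> val Delta D ->
  selected s D <-> s Delta = D.
Proof.
move=> cs dD; split=> [UD|<-]; last by exists Delta.
have uS := selected_ultrafilter cs.
apply: (@ultrafilter_block_unique _ Delta _ _ uS) UD => //.
  exact: (proj1 cs).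
by exists Delta.
Qed.

(** * Inverse limits of sub-collections of blocks *)

Section Limit.
Variable phi : FP I -> FPS I.
Hypothesis mono : forall Delta' Delta,
  FP_le Delta' Delta -> FPS_le (phi Delta') (phi Delta).
Hypothesis phi_sub : forall Delta, val (phi Delta) `<=` val Delta.
Variable W : set (set (set I)).
Hypothesis WP : forall U, W U <-> ultrafilters I U /\
  forall Delta D, val Delta D -> U D -> val (phi Delta) D.

Let L := inverse_limit (pullback_family mono (FPS_family I)).

Let block (a : L) Delta : set I := val (lim_proj Delta a : val (phi Delta)).

Lemma block_coherent (a : L) : coherent_selection (block a).
Proof.
split=> [Delta|Delta' Delta le]; first by apply: phi_sub; exact: set_valP.
by rewrite /block /lim_proj (svalP a _ _ le); exact: psiP.
Qed.

Lemma block_inj (a b : L) : block a = block b -> a = b.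
Proof.
case: a b => [a aP] [b bP] ab; apply: eq_exist.
apply: functional_extensionality_dep => Delta.
by apply: val_inj; exact: (congr1 (fun s => s Delta) ab).
Qed.

(** The transition map sends the block in [U] to a superset, which is again in
    [U], hence to the only block of the coarser partition in [U]. *)
Lemma ultrafilter_limit_point (U : W) :
  exists a : L, forall Delta, val U (block a Delta).
Proof.
have [uU Uphi] := (WP (val U)).1 (set_valP U).
have ex Delta : exists D : val (phi Delta), val U (val D).
  have [D dD UD] := ultrafilter_partition Delta uU.
  by exists (SigSub (mem_set (Uphi _ _ dD UD))).
pose a Delta := sval (cid (ex Delta)).
have Ua Delta : val U (val (a Delta)) := svalP (cid (ex Delta)).
suff aP Delta' Delta (h : FP_le Delta' Delta) :
    a Delta = psi (mono h) (a Delta').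
  by exists (exist _ a aP).
apply/esym/psi_unique.
pose B := psi (mono h) (a Delta').
have UB : val U (val B).
  by have [_ Uup _ _] := uU; apply: Uup (Ua Delta') _; exact: psiP.
have <- : val B = val (a Delta).
  by apply: (@ultrafilter_block_unique _ Delta _ _ uU) UB (Ua Delta);
    apply: phi_sub; exact: set_valP.
exact: psiP.
Qed.

(** The inverse of [f] sends a point to the ultrafilter generated by its blocks.
    That it undoes [f] on the left uses only the partitions [split_FP A], which
    already decide whether [A] is in [U]. *)
Lemma ultrafilters_limit : exists f : W -> L,
  bijective f /\
  forall (U : W) Delta (D : val (phi Delta)),
    lim_proj Delta (f U) = D <-> val U (val D).
Proof.
have [f fP] := choice ultrafilter_limit_point.
have fE (U : W) Delta D : val Delta D -> block (f U) Delta = D <-> val U D.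
  move=> dD; split=> [<-|UD]; first exact: fP.
  have [uU _] := (WP (val U)).1 (set_valP U).
  apply: (@ultrafilter_block_unique _ Delta _ _ uU) UD => //.
  exact: (proj1 (block_coherent _)).
have WU (a : L) : W (selected (block a)).
  apply/WP; split; first exact: selected_ultrafilter (block_coherent a).
  move=> Delta D dD /(selectedP (block_coherent a) dD) <-.
  exact: set_valP.
exists f; split; last first.
  move=> U Delta D; rewrite -(fE _ Delta); last exact/phi_sub/set_valP.
  by split=> [<-//|?]; exact: val_inj.
exists (fun a => SigSub (mem_set (WU a))) => [U|a].
  apply: val_inj; have [uU _] := (WP (val U)).1 (set_valP U).
  have [_ Uup _ _] := uU.
  apply/seteqP; split=> A /= => [[Delta sA]|UA]; first exact: Uup (fP _ _) sA.
  exists (split_FP A).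
  suff -> : block (f U) (split_FP A) = A by [].
  by apply/fE => //; split; [left|exact: ultrafilter_ne UA].
apply: block_inj; apply: funext => Delta.
apply/fE; first exact: (proj1 (block_coherent a)).
by exists Delta.
Qed.

End Limit.

(** A set [A] in [U] is the block of [split_FP A] that lies in [U], so requiring
    infinite blocks makes every member of [U] infinite. *)
Lemma free_ultrafiltersP U : free_ultrafilters I U <-> ultrafilters I U /\
  forall Delta D, val Delta D -> U D -> val (Big Delta) D.
Proof.
split=> [[uU infU]|[uU bigU]]; split=> //.
  by move=> Delta D dD UD; split=> //; exact: infU.
move=> A UA; have [] // := bigU (split_FP A) A _ UA.
by split; [left|exact: ultrafilter_ne UA].
Qed.

End UltrafilterLimits.

Theorem theorem3 (I : Type) :
  (exists f : free_ultrafilters I -> inverse_limit (Big_family I),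
     bijective f /\
     forall (U : free_ultrafilters I) (Delta : FP I) (D : val (Big Delta)),
       lim_proj Delta (f U) = D <-> val U (val D)) /\
  (exists g : ultrafilters I -> inverse_limit (FP_family I),
     bijective g /\
     forall (U : ultrafilters I) (Delta : FP I) (D : val Delta),
       lim_proj Delta (g U) = D <-> val U (val D)).
Proof.
split.
  apply: (@ultrafilters_limit I (@Big I) (@Big_mono I)).
    by move=> Delta D [].
  exact: free_ultrafiltersP.
apply: (@ultrafilters_limit I (@FP_incl I) (@FP_incl_mono I)).
  by move=> Delta; exact: subset_refl.
by move=> U; split=> [uU|[]//]; split.
Qed.
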